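(* Let $v\in V$ and $f\in V'$ (identified with an element of $V$) be given. For $\phi\in W$ and $\beta>0$ define $$\eta(\phi)=\|DGv-\phi\|_{D^{-1}}+C_P^{-1}\,\|G^*\phi-f\|_V,$$ $$E(\beta,\phi)=(1+\beta)\,\|DGv-\phi\|_{D^{-1}}^2+(1+1/\beta)\,C_P^{-2}\,\|G^*\phi-f\|_V^2.$$ If $E$, as a function on $(0,\infty)\times W$, attains a local minimum at $(\beta_0,\phi_0)$, then $\eta$ attains a global minimum over $W$ at $\phi_0$.
   Context: Let $V$ and $W$ be real Hilbert spaces with inner products $(\cdot,\cdot)_V$, $(\cdot,\cdot)_W$. Let $G:V\to W$ be an injective bounded linear operator whose Hilbert adjoint $G^*:W\to V$, defined by $(G^*\tau,v)_V=(\tau,Gv)_W$ for all $v\in V$, $\tau\in W$, is surjective with closed range. Let $D:W\to W$ be a bounded linear operator that is symmetric positive definite (in the sense that $(D\tau,\tau)_W\ge c\|\tau\|_W^2$ for some $c>0$ and all $\tau\in W$), so that $D^{-1}$ exists and is bounded. Write $(\sigma,\tau)_{D^{-1}}=(D^{-1}\sigma,\tau)_W$ and $\|\tau\|_{D^{-1}}^2=(\tau,\tau)_{D^{-1}}$. Set $A=G^*DG$, which is positive definite, and $\|v\|_A^2=(Av,v)_V$. The constant $C_P>0$ (Poincaré's constant) is such that $C_P\|v\|_V\le\|v\|_A$ for all $v\in V$. Elements $f$ of the dual $V'$ are identified with elements of $V$ via the Riesz representation, so $f(w)=(f,w)_V$. *)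

(* Defs.v *)
From HB Require Import structures.
From mathcomp Require Import all_boot all_order all_algebra.
From mathcomp Require Import all_classical all_reals all_analysis.

Set Implicit Arguments.
Unset Strict Implicit.
Unset Printing Implicit Defensive.

Import Order.TTheory GRing.Theory Num.Theory.
Import numFieldNormedType.Exports.

Local Open Scope classical_set_scope.
Local Open Scope ring_scope.

(* Completeness comes from the completeNormedModType structure; the last axiom
   makes its norm (hence its topology) the one induced by the inner product. *)
HB.mixin Record CompleteNormedModule_isHilbert (R : realType) V
    of CompleteNormedModule R V := {
  inner : {dot V for @idfun R};
  inner_norm : forall v : V, inner v v = `|v| ^+ 2
}.

#[short(type="hilbertType")]
HB.structure Definition Hilbert (R : realType) :=
  {V of CompleteNormedModule R V & CompleteNormedModule_isHilbert R V}.

Notation "''[' u , v ]" := (inner u%R v%R) : ring_scope.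

Section Operators.
Context {R : realType}.

Definition is_adjoint (V W : hilbertType R) (G : V -> W) (Gs : W -> V) : Prop :=
  forall (v : V) (tau : W), '[Gs tau, v] = '[tau, G v].

Definition self_adjoint (W : hilbertType R) (D : W -> W) : Prop :=
  forall sigma tau : W, '[D sigma, tau] = '[sigma, D tau].

Definition coercive (W : hilbertType R) (D : W -> W) : Prop :=
  exists2 c : R, 0 < c & forall tau : W, c * `|tau| ^+ 2 <= '[D tau, tau].

(* The inverse of a bijective D. Bijectivity is not assumed here: it holds for
   every bounded, self-adjoint, coercive D. *)
Definition inv_op (W : hilbertType R) (D : W -> W) : W -> W :=
  'pinv_(fun=> 0) [set: W] D.

(* For positive T, [op_norm T] is the norm of the inner product
   (x, y) |-> '[T x, y]; it gives ||.||_A for T = A and ||.||_{D^-1} for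
   T = D^-1. *)
Definition op_norm (W : hilbertType R) (T : W -> W) (x : W) : R :=
  Num.sqrt '[T x, x].

End Operators.

Section Minima.
Context {R : realType}.

(* Local minimum of the restriction of f to A, for the subspace topology. *)
Definition local_min_on (T : topologicalType) (A : set T) (f : T -> R) (x0 : T)
    : Prop :=
  A x0 /\ \forall x \near within A (nbhs x0), f x0 <= f x.

Definition global_min (T : Type) (f : T -> R) (x0 : T) : Prop :=
  forall x, f x0 <= f x.

End Minima.

Section Estimators.
Context {R : realType} {V W : hilbertType R}.
Variables (G : V -> W) (Gs : W -> V) (D : W -> W) (CP : R) (v f : V).

Definition eta (phi : W) : R :=
  op_norm (inv_op D) (D (G v) - phi) + CP^-1 * `|Gs phi - f|.

Definition E (beta : R) (phi : W) : R :=
  (1 + beta) * op_norm (inv_op D) (D (G v) - phi) ^+ 2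
  + (1 + 1 / beta) * CP ^- 2 * `|Gs phi - f| ^+ 2.

End Estimators.

(* Main.v *)
(* Write a = ||DGv - phi||_{D^-1} and b = C_P^-1 ||G* phi - f||, both convex in
   phi. Minimality in beta alone forces beta0 a(phi0) = b(phi0), and at such a
   balanced beta the value of E is (a + b)^2 = eta^2. If eta(psi) < eta(phi0),
   follow the segment from phi0 to psi: with A_t >= a and B_t >= b the linear
   interpolations of the end values, beta_t = B_t / A_t tends to beta0 and
   E(beta_t, phi_t) <= (A_t + B_t)^2 < eta(phi0)^2, against local minimality.
   Convexity of ||.||_{D^-1} needs D to be onto, since inv_op is 0 off its range. *)
Require Import Defs.
From mathcomp Require Import all_boot all_order all_algebra.
From mathcomp Require Import all_classical all_reals all_analysis.
From mathcomp Require Import ring lra.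

Import Order.TTheory GRing.Theory Num.Theory.
Import numFieldNormedType.Exports.

Local Open Scope classical_set_scope.
Local Open Scope ring_scope.

(** * Bilinearity of the inner product; linear and bounded maps *)

Section InnerProduct.
Context {R : realType} {H : hilbertType R}.
Implicit Types x y z : H.

Lemma innerC x y : '[x, y] = '[y, x].
Proof. by rewrite (hermC inner) expr0 mul1r. Qed.

Lemma innerDl x y z : '[x + y, z] = '[x, z] + '[y, z].
Proof. exact: linearDl. Qed.

Lemma innerZl (a : R) x y : '[a *: x, y] = a * '[x, y].
Proof. exact: linearZl_LR. Qed.

Lemma innerDr x y z : '[x, y + z] = '[x, y] + '[x, z].
Proof. by rewrite innerC innerDl !(innerC x). Qed.

Lemma innerZr (a : R) x y : '[x, a *: y] = a * '[x, y].
Proof. by rewrite innerC innerZl innerC. Qed.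

Lemma inner_inj x y : (forall z, '[x, z] = '[y, z]) -> x = y.
Proof.
move=> xy; apply/eqP; rewrite -subr_eq0 -normr_eq0 -sqrf_eq0 -inner_norm.
by rewrite -[- y]scaleN1r innerDl innerZl xy mulN1r subrr.
Qed.

End InnerProduct.

(** [Gs] is a bare function: testing against every [z] lets the adjoint relation force its
    linearity, on which convexity of [phi |-> |Gs phi - f|] rests. *)
Lemma adjoint_linear {R : realType} {V W : hilbertType R} (G : V -> W)
  (Gs : W -> V) : is_adjoint G Gs -> linear Gs.
Proof.
move=> adj a x y; apply: inner_inj => z.
by rewrite innerDl innerZl !adj innerDl innerZl.
Qed.

(** [bounded_fun_norm] gives one bound per ball; rescaling [x] to norm 1 turns the bound on the unit
    ball into a Lipschitz constant. *)
Lemma bounded_linear_le {R : realType} {V W : normedModType R}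
    (f : {linear V -> W}) : bounded_fun_norm f ->
  exists2 M : R, 0 <= M & forall x, `|f x| <= M * `|x|.
Proof.
move=> /(_ 1)[M fM].
have M0 : 0 <= M by rewrite -(normr0 W) -(linear0 f) fM// normr0.
exists M => // x; have [->|x0] := eqVneq x 0.
  by rewrite linear0 !normr0 mulr0.
have nx0 : 0 < `|x| by rewrite normr_gt0.
have := fM (`|x|^-1 *: x).
rewrite linearZ/= !normrZ normfV normr_id mulVf ?gt_eqF// => /(_ (lexx _)).
by rewrite ler_pdivrMl// mulrC.
Qed.

(** * Coercive operators: solvability and the energy norm *)

Section CoerciveOperator.
Context {R : realType} {W : hilbertType R} (D : {linear W -> W}).
Hypothesis D_coercive : coercive D.

Lemma coercive_form_ge0 x : 0 <= '[D x, x].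
Proof.
case: D_coercive => c c0 /(_ x); apply: le_trans.
by rewrite mulr_ge0 ?sqr_ge0// ltW.
Qed.

Lemma coercive_inj : injective D.
Proof.
case: D_coercive => c c0 Dc x y Dxy; apply/eqP; rewrite -subr_eq0 -normr_eq0.
have := Dc (x - y); rewrite (linearB D) Dxy subrr.
rewrite -[X in '[X, _]](scale0r 0) innerZl mul0r => h.
rewrite -sqrf_eq0 eq_le sqr_ge0 andbT.
by move: h; rewrite pmulr_rle0.
Qed.

(* Lax-Milgram: for small rho > 0, x |-> x - rho (D x - y) is a contraction
   whose fixed point solves D x = y. *)
Lemma coercive_surj : bounded_fun_norm D -> forall y, exists x, D x = y.
Proof.
move=> /bounded_linear_le[M0 M00 DM0] y; case: D_coercive => c c0 Dc.
(* Adding [c] ensures [0 < c <= M], hence [0 <= 1 - rho * c] below. *)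
pose M := M0 + c.
have M_gt0 : 0 < M by rewrite /M; lra.
have DM x : `|D x| <= M * `|x|.
  by apply: (le_trans (DM0 x)); rewrite ler_wpM2r// /M; lra.
(* This [rho] minimises [1 - 2 rho c + rho^2 M^2], a bound for the squared contraction factor; the
   minimum is [1 - rho c]. *)
pose rho := c / M ^+ 2.
have rho_gt0 : 0 < rho by rewrite divr_gt0// exprn_gt0.
have k_lt1 : 1 - rho * c < 1 by have := mulr_gt0 rho_gt0 c0; lra.
have k_ge0 : 0 <= 1 - rho * c.
  rewrite subr_ge0 /rho mulrAC ler_pdivrMr ?exprn_gt0// mul1r -expr2.
  by rewrite lerXn2r ?nnegrE ?(ltW c0) ?(ltW M_gt0)// /M; lra.
pose F (x : W) : W := x - rho *: (D x - y).
pose q : {nonneg R} := NngNum (sqrtr_ge0 (1 - rho * c)).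
have F_contr : is_contraction (totalfun F).
  exists q; split=> /=.
    by rewrite -[X in _ < X]sqrtr1 ltr_sqrt.
  move=> [x z] _ /=.
  have -> : F x - F z = (x - z) + (- rho) *: D (x - z).
    rewrite /F opprD opprK addrACA; congr (_ + _).
    rewrite addrC -scalerBr opprB addrA subrK scaleNr.
    by rewrite (linearB D) -scalerN opprB.
  move: (x - z) => u.
  rewrite -(ler_pXn2r (n := 2))// ?nnegrE ?mulr_ge0 ?sqrtr_ge0//.
  rewrite exprMn sqr_sqrtr// -inner_norm !innerDl !innerDr !innerZl !innerZr.
  rewrite !inner_norm (innerC u).
  have h1 := Dc u.
  have h2 : `|D u| ^+ 2 <= M ^+ 2 * `|u| ^+ 2.
    by rewrite -exprMn lerXn2r ?nnegrE ?mulr_ge0 ?(ltW M_gt0).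
  have h3 : rho * (c * `|u| ^+ 2) <= rho * '[D u, u] by rewrite ler_wpM2l// ltW.
  have h4 : rho * (rho * `|D u| ^+ 2) <= rho * (c * `|u| ^+ 2).
    rewrite ler_wpM2l ?(ltW rho_gt0)//.
    apply: (le_trans (ler_wpM2l (ltW rho_gt0) h2)).
    by rewrite mulrA /rho divfK// expf_neq0// gt_eqF.
  lra.
have [|p _ Fp] := banach_fixed_point F_contr closedT; first by exists 0.
exists p; apply/eqP; rewrite -subr_eq0.
have : rho *: (D p - y) = 0.
  by apply: oppr_inj; apply: (addrI p); rewrite oppr0 addr0.
by move=> /eqP; rewrite scaler_eq0 gt_eqF.
Qed.

Hypothesis D_sym : self_adjoint D.

Lemma coercive_cauchy_schwarz x y :
  '[D x, y] <= Num.sqrt '[D x, x] * Num.sqrt '[D y, y].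
Proof.
have := coercive_form_ge0; set p := fun x => '[D x, x] => p_ge0.
apply: (le_trans (ler_norm _)).
rewrite -sqrtrM ?p_ge0// -sqrtr_sqr ler_sqrt ?mulr_ge0 ?p_ge0//.
have [->|y0] := eqVneq y 0.
  by rewrite (linear0 D) -(scale0r 0) innerZr !innerZr !mul0r expr0n mulr0.
have py : 0 < p y.
  case: D_coercive => c c0 /(_ y); apply: lt_le_trans.
  by rewrite mulr_gt0// exprn_gt0// normr_gt0.
(* The form at this vector equals [p y * (p x * p y - b^2)], and [p y] can be cancelled. *)
have := p_ge0 (p y *: x + (- '[D x, y]) *: y).
rewrite /p (linearD D) !(linearZ_LR D) !innerDl !innerDr !innerZl !innerZr.
rewrite (D_sym y x) (innerC y (D x)) -/(p x) -/(p y).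
set b := '[D x, y] => h.
have : 0 <= p y * (p x * p y - b ^+ 2) by lra.
by rewrite pmulr_rge0// subr_ge0.
Qed.

Lemma coercive_form_triangle x y :
  Num.sqrt '[D (x + y), x + y] <= Num.sqrt '[D x, x] + Num.sqrt '[D y, y].
Proof.
have := coercive_cauchy_schwarz x y.
set a := Num.sqrt '[D x, x]; set b := Num.sqrt '[D y, y] => cs.
have a0 : 0 <= a := sqrtr_ge0 _; have b0 : 0 <= b := sqrtr_ge0 _.
rewrite -(@ger0_norm _ (a + b)) ?addr_ge0// -sqrtr_sqr ler_sqrt ?sqr_ge0//.
rewrite (linearD D) !innerDl !innerDr (D_sym y x) (innerC y (D x)).
have -> : '[D x, x] = a ^+ 2 by rewrite sqr_sqrtr ?coercive_form_ge0.
have -> : '[D y, y] = b ^+ 2 by rewrite sqr_sqrtr ?coercive_form_ge0.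
lra.
Qed.

Hypothesis D_bounded : bounded_fun_norm D.

Lemma inv_opK x : inv_op D (D x) = x.
Proof. by apply: pinvKV; rewrite ?in_setE// => ? ? _ _; apply: coercive_inj. Qed.

(** Pulling back through [D] trades the norm of the inverse for the energy norm of [D], so linearity
    of [inv_op D] never has to be proved. *)
Lemma op_norm_inv x : op_norm (inv_op D) (D x) = Num.sqrt '[D x, x].
Proof. by rewrite /op_norm inv_opK innerC. Qed.

Lemma op_norm_inv_convex (t : R) x y : 0 <= t <= 1 ->
  op_norm (inv_op D) ((1 - t) *: x + t *: y) <=
  (1 - t) * op_norm (inv_op D) x + t * op_norm (inv_op D) y.
Proof.
move=> /andP[t0 t1].
have [u <-] := coercive_surj D_bounded x.
have [w <-] := coercive_surj D_bounded y.
rewrite -!(linearZ_LR D) -(linearD D) !op_norm_inv.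
apply: (le_trans (coercive_form_triangle _ _)).
have hom (s : R) z : 0 <= s ->
    Num.sqrt '[D (s *: z), s *: z] = s * Num.sqrt '[D z, z].
  move=> s0; rewrite (linearZ_LR D) innerZl innerZr mulrA -expr2.
  by rewrite sqrtrM ?sqr_ge0// sqrtr_sqr ger0_norm.
by rewrite !hom// subr_ge0.
Qed.

End CoerciveOperator.

(** * The weighted sum of squares as a function of real numbers *)

Section Majorant.
Context {R : realType}.
Implicit Types a b beta s t : R.

(** The form of [E] once [C_P^-1] is absorbed into [b]. *)
Definition majorant beta a b := (1 + beta) * a ^+ 2 + (1 + 1 / beta) * b ^+ 2.

Lemma majorant_le beta a a' b b' : 0 < beta -> 0 <= a <= a' -> 0 <= b <= b' ->
  majorant beta a b <= majorant beta a' b'.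
Proof.
move=> beta0 /andP[a0 aa'] /andP[b0 bb'].
have ? : 0 < 1 / beta by rewrite divr_gt0.
have sq x y : 0 <= x -> x <= y -> x ^+ 2 <= y ^+ 2.
  by move=> x0 xy; rewrite lerXn2r ?nnegrE ?(le_trans x0 xy).
by apply: lerD; (apply: ler_wpM2l; [lra|exact: sq]).
Qed.

(** Equality case of Young's inequality: both sides become [(1 + beta)^2 a^2], also when [a = 0]. *)
Lemma majorant_balanced beta a b : 0 < beta -> beta * a = b ->
  majorant beta a b = (a + b) ^+ 2.
Proof. by move=> beta0 <-; rewrite /majorant; field; rewrite gt_eqF. Qed.

(* Comparing beta with beta (1 + s): the sign of s decides which of the two
   inequalities between (beta a)^2 and b^2 comes out in the limit s -> 0. *)
Lemma majorant_local_min beta a b : 0 < beta -> 0 <= a -> 0 <= b ->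
  (\forall g \near beta, majorant beta a b <= majorant g a b) -> beta * a = b.
Proof.
move=> beta0 a0 b0 hmin.
have cvg_mul1D k : k * (1 + s) @[s --> (0 : R)] --> k.
  have : k * (1 + s) @[s --> (0 : R)] --> k * (1 + 0).
    by apply: cvgM; [exact: cvg_cst|apply: cvgD; [exact: cvg_cst|exact: cvg_id]].
  by rewrite addr0 mulr1.
have key : \forall s \near (0 : R),
    0 <= s * ((beta * a) ^+ 2 * (1 + s) - b ^+ 2).
  have s1 : \forall s \near (0 : R), -1 < s by apply: (cvgr_gt _ cvg_id); lra.
  have := cvg_mul1D beta _ hmin; apply: filterS2 s1 => s s1; rewrite /majorant /= -subr_ge0.
  have s1_gt0 : 0 < 1 + s by lra.
  (* Multiplying the increment of [majorant] by [beta (1 + s)] clears its denominators. *)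
  rewrite -(pmulr_rge0 _ (mulr_gt0 beta0 s1_gt0)); congr (0 <= _).
  by field; rewrite !gt_eqF.
apply/eqP; rewrite -(eqrXn2 (n := 2))// ?mulr_ge0 ?(ltW beta0)//.
case: ltgtP => // lt_ab.
- have [e /= e0 He] := iffLR (nbhs_ballP _ _) (filterI key (cvgr_lt _ (cvg_mul1D _) _ lt_ab)).
  have [|/=] := He (e / 2).
    by rewrite /ball /= sub0r normrN gtr0_norm; lra.
  by rewrite pmulr_rge0; lra.
- have [e /= e0 He] := iffLR (nbhs_ballP _ _) (filterI key (cvgr_gt _ (cvg_mul1D _) _ lt_ab)).
  have [|/=] := He (- (e / 2)).
    by rewrite /ball /= sub0r opprK gtr0_norm; lra.
  by rewrite mulNr oppr_ge0 pmulr_rle0; lra.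
Qed.

End Majorant.

(** * Descent along a segment *)

Theorem lemma3p5 (R : realType) (V W : hilbertType R)
    (G : {linear V -> W}) (Gs : W -> V) (D : {linear W -> W}) (CP : R)
    (G_inj : injective G) (G_bounded : bounded_fun_norm G)
    (Gs_adjoint : is_adjoint G Gs)
    (Gs_surj : range Gs = [set: V]) (Gs_closed : closed (range Gs))
    (D_bounded : bounded_fun_norm D) (D_sym : self_adjoint D)
    (D_coercive : coercive D)
    (CP_gt0 : 0 < CP)
    (poincare : forall v : V, CP * `|v| <= op_norm (Gs \o D \o G) v)
    (v f : V) (beta0 : R) (phi0 : W) :
  local_min_on [set x : R * W | 0 < x.1]
    (fun x => E G Gs D CP v f x.1 x.2) (beta0, phi0) ->
  global_min (eta G Gs D CP v f) phi0.
Proof.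
move=> [/= beta0_gt0 hmin] psi; rewrite leNgt; apply/negP => lt_eta.
pose a phi := op_norm (inv_op D) (D (G v) - phi).
pose b phi := CP^-1 * `|Gs phi - f|.
have E_majorant beta phi :
    E G Gs D CP v f beta phi = majorant beta (a phi) (b phi).
  by rewrite /E /majorant /b exprMn exprVn (mulrA _ (CP ^- 2)).
have a_ge0 phi : 0 <= a phi by exact: sqrtr_ge0.
have b_ge0 phi : 0 <= b phi by rewrite mulr_ge0 ?invr_ge0// ltW.
pose path t := (1 - t) *: phi0 + t *: psi.
pose A t := (1 - t) * a phi0 + t * a psi.
pose B t := (1 - t) * b phi0 + t * b psi.
have a_le t : 0 <= t <= 1 -> a (path t) <= A t.
  move=> t01; rewrite /A.
  apply: le_trans
    (op_norm_inv_convex D D_coercive D_sym D_bounded _ _ _ t01).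
  (* The residual is affine in [phi], so on the path it is the convex combination of its end
     values. *)
  rewrite /a /path le_eqVlt; apply/orP; left; apply/eqP; congr (op_norm _ _).
  rewrite !scalerBr opprD addrACA; congr (_ + _).
  by rewrite -scalerDl subrK scale1r.
have b_le t : 0 <= t <= 1 -> b (path t) <= B t.
  move=> /andP[t0 t1]; rewrite /B /b !(mulrCA _ CP^-1) -mulrDr.
  rewrite ler_wpM2l ?invr_ge0 ?(ltW CP_gt0)//.
  have GsD x y : Gs (x + y) = Gs x + Gs y.
    by have := adjoint_linear G Gs Gs_adjoint 1 x y; rewrite !scale1r.
  have Gs0 : Gs 0 = 0 by apply: (addrI (Gs 0)); rewrite -GsD !addr0.
  have GsZ s x : Gs (s *: x) = s *: Gs x.
    by have := adjoint_linear G Gs Gs_adjoint s x 0; rewrite !addr0 Gs0 addr0.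
  have -> : Gs (path t) - f = (1 - t) *: (Gs phi0 - f) + t *: (Gs psi - f).
    rewrite GsD !GsZ !scalerBr addrACA -opprD; congr (_ - _).
    by rewrite -scalerDl subrK scale1r.
  apply: (le_trans (ler_normD _ _)).
  by rewrite !normrZ !ger0_norm// subr_ge0.
(* Stated for any normed space to serve both the scalars [A t], [B t] and the path in [W]. *)
have t_cvg (U : normedModType R) (x y : U) :
    (1 - t) *: x + t *: y @[t --> (0 : R)] --> x.
  have : (1 - t) *: x + t *: y @[t --> (0 : R)] -->
      (1 - 0 : R) *: x + (0 : R) *: y.
    apply: cvgD; apply: cvgZ; [|exact: cvg_cst|exact: cvg_id|exact: cvg_cst].
    by apply: cvgB; [exact: cvg_cst|exact: cvg_id].
  by rewrite subr0 scale1r scale0r addr0.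
have A_cvg : A t @[t --> (0 : R)] --> a phi0 := t_cvg _ (a phi0 : R^o) (a psi : R^o).
have B_cvg : B t @[t --> (0 : R)] --> b phi0 := t_cvg _ (b phi0 : R^o) (b psi : R^o).
have path_cvg : path t @[t --> (0 : R)] --> phi0 := t_cvg W phi0 psi.
have balanced : beta0 * a phi0 = b phi0.
  apply: majorant_local_min => //.
  have g_gt0 : \forall g \near beta0, 0 < g by exact: (cvgr_gt _ cvg_id).
  (* Local minimality is restricted to the slice [g |-> (g, phi0)]. *)
  have phi0_cvg : phi0 @[_ --> beta0] --> phi0 by exact: cvg_cst.
  have g_min : \forall g \near beta0, 0 < g ->
      E G Gs D CP v f beta0 phi0 <= E G Gs D CP v f g phi0 .
    by exact: (@cvg_pair _ _ _ _ _ _ _ _ _ id _ cvg_id phi0_cvg _ hmin).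
  by apply: filterS2 g_gt0 g_min => g g0 /(_ g0); rewrite !E_majorant.
(* Otherwise balance gives [b phi0 = 0], so [eta] vanishes at [phi0] and cannot be larger than at
   [psi]. *)
have a0_gt0 : 0 < a phi0.
  rewrite lt_def a_ge0 andbT; apply/eqP => a0.
  move: lt_eta; rewrite /eta -/(a phi0) -/(b phi0) -balanced a0 mulr0 addr0.
  by apply/negP; rewrite -leNgt addr_ge0 ?a_ge0 ?b_ge0.
have ratio_cvg : B t / A t @[t --> (0 : R)] --> beta0.
  have -> : beta0 = b phi0 / a phi0 by rewrite -balanced mulfK// gt_eqF.
  apply: cvgM; first exact: B_cvg.
  by apply: cvgV; [rewrite gt_eqF|exact: A_cvg].
have A_gt0 : \forall t \near (0 : R), 0 < A t by exact: cvgr_gt A_cvg _ a0_gt0.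
have ratio_gt0 : \forall t \near (0 : R), 0 < B t / A t.
  by exact: cvgr_gt ratio_cvg _ beta0_gt0.
have path_min : \forall t \near (0 : R), 0 < B t / A t ->
    E G Gs D CP v f beta0 phi0 <= E G Gs D CP v f (B t / A t) (path t) .
  by exact: (@cvg_pair _ _ _ _ _ _ _ _ _ _ _ ratio_cvg path_cvg _ hmin).
have [e /= e0 He] := iffLR (nbhs_ballP _ _) (filterI (filterI A_gt0 ratio_gt0) path_min).
(* The cap [1] keeps the convexity bounds valid; [e / 2] keeps [t] inside the ball. *)
pose t := Num.min 1 (e / 2).
have t_gt0 : 0 < t by rewrite lt_min ltr01 divr_gt0.
have t_le1 : t <= 1 by rewrite ge_min lexx.
have [|[At0 rt0] /= /(_ rt0)] := He t.
  rewrite /ball /= sub0r normrN gtr0_norm// gt_min; apply/orP; right; lra.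
have t01 : 0 <= t <= 1 by rewrite ltW.
rewrite !E_majorant (majorant_balanced _ _ _ beta0_gt0 balanced).
have := @majorant_le _ _ _ (A t) _ (B t) rt0
  (introT andP (conj (a_ge0 _) (a_le t t01)))
  (introT andP (conj (b_ge0 _) (b_le t t01))).
rewrite (majorant_balanced _ _ _ rt0 (divfK (lt0r_neq0 At0) (B t))) => h1 h2.
have := le_trans h2 h1; apply/negP; rewrite -ltNge.
have AB_ge0 : 0 <= A t + B t.
  by apply: addr_ge0; apply: le_trans (a_le t t01) || apply: le_trans (b_le t t01).
rewrite ltrXn2r// ?nnegrE ?addr_ge0//.
(* This product is exactly the drop from [a phi0 + b phi0] to [A t + B t]. *)
have : 0 < t * (eta G Gs D CP v f phi0 - eta G Gs D CP v f psi).
  by rewrite mulr_gt0// subr_gt0.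
rewrite /eta -/(a phi0) -/(b phi0) -/(a psi) -/(b psi) /A /B; lra.
Qed.
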